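(* There exists an operator $A\in\Gamma$ with $A\notin\Gamma_+$. That is, there is a bounded self-adjoint positive semidefinite operator $A:\ell_2\to\ell_2$ with $\sum_{k,l=1}^\infty|\langle A\delta_k,\delta_l\rangle|<\infty$ for which there is no sequence $(x_k)_{k=1}^\infty\subset\ell_1$ satisfying both $A=\sum_{k=1}^\infty x_kx_k^*$ (strongly) and $\sum_{k=1}^\infty\|x_k\|_1^2<\infty$.
   Context: Scalars are $\mathbb{R}$ or $\mathbb{C}$; $\ell_p=\ell_p(\mathbb{N})$ with standard basis $(\delta_k)$; for $x\in\ell_1\subset\ell_2$, $xx^*$ is the rank-one operator $v\mapsto\langle v,x\rangle x$. $\Gamma$ is the set of bounded self-adjoint operators $A:\ell_2\to\ell_2$ with $\langle Ax,x\rangle\ge0$ for all $x\in\ell_2$ and $\|A\|_{1,1}:=\sum_{k,l}|\langle A\delta_k,\delta_l\rangle|<\infty$. For $A\in\Gamma$, $\gamma_+(A):=\inf\{\sum_{k=1}^\infty\|x_k\|_1^2: (x_k)\subset\ell_1,\ A=\sum_{k=1}^\infty x_kx_k^*\text{ strongly}\}$ with $\inf\varnothing=\infty$, and $\Gamma_+:=\{A\in\Gamma:\gamma_+(A)<\infty\}$. *)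

(* Defs.v *)
From HB Require Import structures.
From mathcomp Require Import all_boot all_order all_algebra.
From mathcomp Require Import all_classical all_reals all_analysis.
From mathcomp Require Import complex ring.

Set Implicit Arguments.
Unset Strict Implicit.
Unset Printing Implicit Defensive.

Import Order.TTheory GRing.Theory Num.Theory.
Import numFieldNormedType.Exports.

Local Open Scope classical_set_scope.
Local Open Scope ring_scope.

(* A scalar field over the reals [R]: a field with a conjugation and a modulus
   valued in [R].  The norm of a [numFieldType] takes its values in the field
   itself, hence the real-valued modulus [sabs].  Only the two instances
   [real_scalars] and [complex_scalars] are meant to be used. *)
Record scalars (R : realType) := Scalars {
  scalar :> numFieldType ;
  sconj : scalar -> scalar ;
  sembed : {rmorphism R -> scalar} ;
  sabs : scalar -> R ;
  sembed_le : {mono sembed : x y / x <= y} ;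
  sabsE : forall a : scalar, `|a| = sembed (sabs a) }.

Definition real_scalars (R : realType) : scalars R :=
  @Scalars R R idfun idfun (fun a => `|a|) (fun _ _ => erefl) (fun _ => erefl).

Lemma real_complex_le (R : realType) :
  {mono (real_complex R) : x y / x <= y}.
Proof. by move=> x y; rewrite lecR. Qed.

Definition complex_scalars (R : realType) : scalars R :=
  @Scalars R R[i] conjc (real_complex R) (@ComplexField.Normc.normc R)
    (@real_complex_le R) (fun _ => erefl).

Section SabsTheory.
Variables (R : realType) (K : scalars R).
Implicit Types a b : K.

Lemma sabs_ge0 a : 0 <= sabs a.
Proof. by rewrite -(sembed_le K) rmorph0 -sabsE. Qed.

Lemma sembed_inj : injective (sembed K).
Proof. exact: fmorph_inj. Qed.

Lemma sabs0 : sabs (0 : K) = 0.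
Proof. by apply: sembed_inj; rewrite -sabsE normr0 rmorph0. Qed.

Lemma sabsM a b : sabs (a * b) = sabs a * sabs b.
Proof. by apply: sembed_inj; rewrite rmorphM -!sabsE normrM. Qed.

Lemma ler_sabsD a b : sabs (a + b) <= sabs a + sabs b.
Proof. by rewrite -(sembed_le K) rmorphD -!sabsE ler_normD. Qed.

End SabsTheory.

Section Ell.
Variables (R : realType) (K : scalars R).

Definition seq_norm1 (x : nat -> K) : \bar R :=
  (\sum_(0 <= k <oo) (sabs (x k))%:E)%E.

Definition seq_sqnorm2 (x : nat -> K) : \bar R :=
  (\sum_(0 <= k <oo) (sabs (x k) ^+ 2)%:E)%E.

Definition ell2_pred : {pred nat -> K^o} := [pred x | (seq_sqnorm2 x < +oo)%E].

Lemma ell2_pred_submod : submod_closed ell2_pred.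
Proof.
split.
  rewrite inE /= /seq_sqnorm2 eseries0 ?ltry// => k _ _.
  by rewrite /= sabs0 expr0n.
move=> a x y; rewrite !inE /= => hx hy.
apply: (@le_lt_trans _ _
  ((2 * sabs (a : K) ^+ 2)%:E * seq_sqnorm2 x + 2%:E * seq_sqnorm2 y)%E).
  rewrite /seq_sqnorm2 -!nneseriesZl; first last.
  - by move=> k _; rewrite lee_fin exprn_ge0 ?sabs_ge0.
  - by move=> k _; rewrite lee_fin exprn_ge0 ?sabs_ge0.
  rewrite -nneseriesD; first last.
  - by move=> k _ _; rewrite -EFinM lee_fin mulr_ge0 ?exprn_ge0 ?sabs_ge0.
  - move=> k _ _; rewrite -EFinM lee_fin.
    by rewrite !mulr_ge0 ?exprn_ge0 ?sabs_ge0.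
  apply: lee_nneseries => k _.
    by move=> _; rewrite lee_fin exprn_ge0 ?sabs_ge0.
  rewrite -!EFinM -EFinD lee_fin.
  have h : sabs (a * x k + y k : K) <= sabs (a : K) * sabs (x k) + sabs (y k).
    by rewrite (le_trans (ler_sabsD _ _))// sabsM.
  rewrite (le_trans (lerXn2r 2 _ _ h)) ?nnegrE ?sabs_ge0//.
    by rewrite addr_ge0 ?mulr_ge0 ?sabs_ge0.
  rewrite -mulrA -exprMn -subr_ge0.
  set u := _ * sabs (x k); set v := sabs (y k).
  suff -> : 2 * u ^+ 2 + 2 * v ^+ 2 - (u + v) ^+ 2 = (u - v) ^+ 2.
    exact: sqr_ge0.
  by ring.
by rewrite lte_add_pinfty// lte_mul_pinfty// ?lee_fin ?mulr_ge0 ?exprn_ge0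
  ?sabs_ge0.
Qed.

HB.instance Definition _ :=
  GRing.isSubmodClosed.Build K (nat -> K^o) ell2_pred ell2_pred_submod.

Record ell2 := Ell2 { ell2_val :> nat -> K^o ; _ : ell2_val \in ell2_pred }.

HB.instance Definition _ := [isSub for ell2_val].
HB.instance Definition _ := [Choice of ell2 by <:].
HB.instance Definition _ := [SubChoice_isSubLmodule of ell2 by <:].

Definition norm2 (x : ell2) : R := Num.sqrt (fine (seq_sqnorm2 x)).

Definition inner (x y : ell2) : K :=
  lim (series (fun k => (x k : K) * sconj (y k : K)) @ \oo).

Definition delta_seq (k : nat) : nat -> K^o := fun j => (j == k)%:R.

Lemma delta_subproof (k : nat) : delta_seq k \in ell2_pred.
Proof.
rewrite inE /= /seq_sqnorm2 (@nneseries_split _ _ 0 k.+1); last first.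
  by move=> j _; rewrite lee_fin exprn_ge0 ?sabs_ge0.
rewrite eseries0 ?adde0 ?add0n ?sumEFin ?ltry// => j kj _.
by rewrite /delta_seq gtn_eqF// sabs0 expr0n.
Qed.

Definition delta (k : nat) : ell2 := Ell2 (delta_subproof k).

Definition bounded_op (A : ell2 -> ell2) : Prop :=
  exists M : R, forall x, norm2 (A x) <= M * norm2 x.

Definition self_adjoint (A : ell2 -> ell2) : Prop :=
  forall x y, inner (A x) y = inner x (A y).

Definition norm11 (A : ell2 -> ell2) : \bar R :=
  (\esum_(kl in [set: nat * nat])
     (sabs (inner (A (delta kl.1)) (delta kl.2)))%:E)%E.

(* For complex scalars, [0 <= a] means that [a] is a nonnegative real. *)
Definition Gamma : set {linear ell2 -> ell2} :=
  [set A | [/\ bounded_op A, self_adjoint A,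
               forall x, 0 <= inner (A x) x &
               (norm11 A < +oo)%E]].

Definition rank_one (x v : ell2) : ell2 := inner v x *: x.

Definition strong_sum (B : nat -> ell2 -> ell2) (A : ell2 -> ell2) : Prop :=
  forall v, norm2 (A v - \sum_(0 <= k < n) B k v) @[n --> \oo] --> (0 : R).

(* As [ell_1] is contained in [ell_2], a sequence in [ell_1] is a sequence in
   [ell2] whose terms all have finite [seq_norm1]. *)
Definition gamma_plus (A : ell2 -> ell2) : \bar R :=
  ereal_inf [set s | exists x : nat -> ell2,
    [/\ forall k, (seq_norm1 (x k) < +oo)%E,
        strong_sum (fun k => rank_one (x k)) A &
        s = (\sum_(0 <= k <oo) seq_norm1 (x k) ^+ 2)%E]].

Definition Gamma_plus : set {linear ell2 -> ell2} :=
  [set A | Gamma A /\ (gamma_plus A < +oo)%E].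

End Ell.

(* Main.v *)
From HB Require Import structures.
Require Import Defs.
From mathcomp Require Import all_boot all_order all_algebra.
From mathcomp Require Import all_classical all_reals all_analysis.
From mathcomp Require Import complex ring lra zify.

(** Let H = (J - 2 I) / 2 be the symmetric 4 x 4 orthogonal matrix with entries
    +-1/2, and P = (1/2) [[I, H], [H, I]], a projection of rank 4 in dimension 8
    whose entries have absolute values summing to 12.  A fixed vector (u, H u)
    of P satisfies 4 ||x||_2^2 <= ||x||_1^2, because every entry of one half is
    at most half the l_1-norm of the other half.  All of this tensorises (the
    inequality by Cauchy-Schwarz): P^(n), the n-th tensor power, has rank 4^n,
    its entries sum to 12^n in absolute value, and its fixed vectors satisfy
    4^n ||x||_2^2 <= ||x||_1^2.

    Take A = (+)_n 14^-n P^(n), a block-diagonal operator.  Then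
    ||A||_{1,1} = sum_n (12/14)^n = 7.  If A = sum_k x_k x_k^*, then on the n-th
    block every x_k lies in the range of P^(n), since I - P^(n) annihilates the
    block of A; hence, taking traces,
    sum_k ||x_k||_1^2 >= 4^n tr (14^-n P^(n)) = (16/14)^n for every n. *)

Set Implicit Arguments.
Unset Strict Implicit.
Unset Printing Implicit Defensive.

Import Order.TTheory GRing.Theory Num.Theory.
Import numFieldNormedType.Exports.

Local Open Scope classical_set_scope.
Local Open Scope ring_scope.

(** * Tensor powers of the 8 x 8 projection *)

(* The n-th block of indices is [bstart n, bstart n.+1), of size 8^n;
   the children of an index i of block n are the indices 8 i + r + 1, r < 8, of
   block n+1, so that block n is identified with {0..7}^n. *)
Fixpoint bstart (n : nat) : nat := if n is m.+1 then (8 * bstart m).+1 else 0%N.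

Arguments bstart : simpl never.

Lemma bstartS n : bstart n.+1 = (8 * bstart n).+1. Proof. by []. Qed.

Lemma bstartE n : (7 * bstart n).+1 = (8 ^ n)%N.
Proof. by elim: n => // n IH; rewrite expnS -IH bstartS; lia. Qed.

Lemma bstart_mono : {mono bstart : m n / (m <= n)%N}.
Proof.
move=> m n; rewrite -(@leq_exp2l 8 m n)// -!bstartE; lia.
Qed.

Lemma leq_bstart n : (n <= bstart n)%N.
Proof. by elim: n => // n IH; rewrite bstartS; lia. Qed.

(** Block n starts at (8^n - 1)/7, so the block containing [k] is read off from the base 8 logarithm
    of 7k + 1. *)
Definition level (k : nat) : nat := trunc_log 8 (7 * k).+1.

Lemma bstart_level k : (bstart (level k) <= k < bstart (level k).+1)%N.
Proof.
have /= := @trunc_log_bounds 8 (7 * k).+1 isT isT.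
rewrite -/(level k) -!bstartE => h; lia.
Qed.

Lemma level_eq n k : (bstart n <= k < bstart n.+1)%N -> level k = n.
Proof. by move=> h; apply: trunc_log_eq => //; rewrite -!bstartE; lia. Qed.

Lemma big_nat_children (V : nmodType) (a b : nat) (f : nat -> V) :
  \sum_((8 * a).+1 <= k < (8 * b).+1) f k =
  \sum_(a <= i < b) \sum_(0 <= r < 8) f (8 * i + r).+1.
Proof.
case: (leqP b a) => [ba|/ltnW ab]; first by rewrite !big_geq//; lia.
elim: b ab => [|b IH]; first by rewrite leqn0 => /eqP ->; rewrite !big_geq.
rewrite leq_eqVlt => /predU1P[->|ab]; first by rewrite !big_geq.
rewrite [RHS]big_nat_recr//= -IH// (@big_cat_nat _ _ _ (8 * b).+1)/=; [|lia..].
congr (_ + _).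
rewrite -{1}[(8 * b).+1]add0n big_addn.
have -> : ((8 * b.+1).+1 - (8 * b).+1 = 8)%N by lia.
by apply: eq_bigr => i _; congr f; lia.
Qed.

Lemma big_block (V : nmodType) n (f : nat -> V) :
  \sum_(bstart n.+1 <= k < bstart n.+2) f k =
  \sum_(bstart n <= i < bstart n.+1) \sum_(0 <= r < 8) f (8 * i + r).+1.
Proof. exact: big_nat_children. Qed.

Section TensorProjection.
Variable F : numFieldType.
Implicit Types (x : nat -> F) (n k l r s : nat).

(* [hproj] is the matrix P of the header, with the indices of the two halves
   interleaved according to parity. *)
Definition hcoef r s : int :=
  if r == s then 2
  else if odd (r + s) then (if r./2 == s./2 then -1 else 1) else 0.

Definition hproj r s : F := (hcoef r s)%:~R / 4.

(* The n-th tensor power of [hproj] in the numbering of block n; its values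
   outside of block n are junk. *)
Fixpoint tproj n k l : F :=
  if n is m.+1 then
    hproj (k.-1 %% 8) (l.-1 %% 8) * tproj m (k.-1 %/ 8) (l.-1 %/ 8)
  else ((k == 0) && (l == 0))%:R.

Lemma hprojC r s : hproj r s = hproj s r.
Proof.
by rewrite /hproj /hcoef eq_sym addnC; case: eqP => // _; rewrite [in LHS]eq_sym.
Qed.

Lemma tprojC n k l : tproj n k l = tproj n l k.
Proof. by elim: n k l => [|n IH] k l /=; rewrite 1?andbC// hprojC IH. Qed.

Lemma tprojS n i r j s : (r < 8)%N -> (s < 8)%N ->
  tproj n.+1 (8 * i + r).+1 (8 * j + s).+1 = hproj r s * tproj n i j.
Proof.
move=> r8 s8 /=.
by rewrite ![(8 * _)%N]mulnC !modnMDl !divnMDl// !modn_small// !divn_small// !addn0.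
Qed.

Lemma hproj_idem r s : (r < 8)%N -> (s < 8)%N ->
  \sum_(0 <= t < 8) hproj r t * hproj t s = hproj r s.
Proof.
move=> r8 s8.
(* [hcoef] is 4P over the integers, so P^2 = P becomes 64 integer identities, checked by
   evaluation. *)
have hi : \sum_(0 <= t < 8) hcoef r t * hcoef t s = 4 * hcoef r s.
  have : all (fun r => all (fun s =>
      \sum_(0 <= t < 8) hcoef r t * hcoef t s == 4 * hcoef r s)
      (iota 0 8)) (iota 0 8) by rewrite unlock.
  move=> /allP/(_ r); rewrite mem_iota => /(_ r8)/allP/(_ s).
  by rewrite mem_iota => /(_ s8)/eqP.
rewrite /hproj (eq_bigr (fun t => (hcoef r t * hcoef t s)%:~R / 16)); last first.
  by move=> t _; rewrite intrM; field.
by rewrite -mulr_suml -rmorph_sum/= hi intrM; field.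
Qed.

(** Induction through P^2 = P. The recursion sees [k] and [l] only through residues and quotients by
    8, so junk indices outside the block are covered too. *)
Lemma tproj_idem n k l :
  \sum_(bstart n <= j < bstart n.+1) tproj n k j * tproj n j l = tproj n k l.
Proof.
elim: n k l => [|n IH] k l.
  by rewrite big_nat1 /= eqxx andbT -natrM mulnb.
rewrite big_block /= -IH mulr_sumr.
apply: eq_bigr => i _.
rewrite -(@hproj_idem (k.-1 %% 8) (l.-1 %% 8)) ?ltn_mod// mulr_suml.
apply: eq_big_nat => r /= r8.
rewrite [(8 * i)%N]mulnC modnMDl divnMDl// (modn_small r8) (divn_small r8) addn0.
ring.
Qed.

Lemma tproj_trace n : \sum_(bstart n <= k < bstart n.+1) tproj n k k = 4 ^+ n.
Proof.
elim: n => [|n IH]; first by rewrite big_nat1 expr0.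
rewrite big_block exprS -IH mulr_sumr.
apply: eq_bigr => i _.
transitivity (\sum_(0 <= r < 8) hproj r r * tproj n i i).
  by apply: eq_big_nat => r /andP[_ r8]; rewrite tprojS.
rewrite -mulr_suml; congr (_ * _).
by rewrite /hproj /hcoef; under eq_bigr do rewrite eqxx; rewrite unlock /=; field.
Qed.

Lemma hproj_norm : \sum_(0 <= r < 8) \sum_(0 <= s < 8) `|hproj r s| = 12.
Proof.
(* There are 8 diagonal entries 2 and 32 entries +-1. *)
have hi : \sum_(0 <= r < 8) \sum_(0 <= s < 8) `|hcoef r s| = 48 by rewrite unlock.
transitivity ((\sum_(0 <= r < 8) \sum_(0 <= s < 8) `|hcoef r s|)%:~R / 4 : F).
  rewrite rmorph_sum/= mulr_suml; apply: eq_bigr => r _.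
  rewrite rmorph_sum/= mulr_suml; apply: eq_bigr => s _.
  by rewrite normrM intr_norm normfV normr_nat.
by rewrite hi; field.
Qed.

Lemma tproj_norm n :
  \sum_(bstart n <= k < bstart n.+1) \sum_(bstart n <= l < bstart n.+1) `|tproj n k l|
  = 12 ^+ n.
Proof.
elim: n => [|n IH]; first by rewrite !big_nat1 /= normr1 expr0.
rewrite big_block exprSr -IH mulr_suml.
apply: eq_bigr => i _.
under eq_bigr do rewrite big_block.
rewrite exchange_big mulr_suml; apply: eq_bigr => j _.
rewrite -hproj_norm mulr_sumr; apply: eq_big_nat => r /andP[_ r8].
rewrite mulr_sumr; apply: eq_big_nat => s /andP[_ s8].
by rewrite tprojS// normrM mulrC.
Qed.

(** With S and S' the l_1-norms of the two parity halves, 2|u_r| is at most the norm of the half not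
    containing r, whence 4 ||u||_2^2 <= 4 S S' <= (S + S')^2. *)
Lemma hfixed_norm (u : nat -> F) :
  (forall r, (r < 8)%N -> \sum_(0 <= s < 8) hproj r s * u s = u r) ->
  4 * \sum_(0 <= r < 8) `|u r| ^+ 2 <= (\sum_(0 <= r < 8) `|u r|) ^+ 2.
Proof.
move=> hu.
have dom r : (r < 8)%N -> `|u r| *+ 2 <= \sum_(0 <= s < 8 | odd (r + s)) `|u s|.
  move=> r8; have -> : `|u r| *+ 2 = `|u r *+ 2| by rewrite normrMn.
  (* In 4 u_r = sum_s [hcoef r s] u_s the diagonal term is 2 u_r; cancelling it leaves the opposite
     parity, with coefficients +-1. *)
  have -> : u r *+ 2 = \sum_(0 <= s < 8 | odd (r + s)) (hcoef r s)%:~R * u s.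
    apply: (@addrI _ (u r *+ 2)); transitivity (4 * u r); first by ring.
    rewrite -[in LHS]hu// mulr_sumr (bigID (fun s => odd (r + s)))/= addrC.
    congr (_ + _); last by apply: eq_bigr => s _; rewrite /hproj; field.
    rewrite big_mkcond (bigD1_seq r)/= ?mem_index_iota ?iota_uniq//.
    rewrite addnn odd_double big1 ?addr0 => [|s /negPf sr].
      by rewrite /hproj /hcoef eqxx; field.
    case: ifP => // /negPf rs.
    by rewrite /hproj /hcoef rs eq_sym sr !mul0r mulr0.
  apply: le_trans (ler_norm_sum _ _ _) _; apply: ler_sum => s rs.
  rewrite normrM /hcoef rs; case: eqP => [rs0|_].
    by move: rs; rewrite rs0 addnn odd_double.
  by case: ifP; rewrite ?rmorphN1 ?normrN1 ?rmorph1 ?normr1 mul1r.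
pose S b := \sum_(0 <= s < 8 | odd s == b) `|u s|.
have sq b : (\sum_(0 <= s < 8 | odd s == b) `|u s| ^+ 2) *+ 2 <= S true * S false.
  rewrite -sumrMnl.
  have -> : S true * S false = \sum_(0 <= s < 8 | odd s == b) `|u s| * S (~~ b).
    by rewrite -mulr_suml; case: b => //; rewrite mulrC.
  rewrite big_nat_cond [leRHS]big_nat_cond.
  apply: ler_sum => s /andP[/andP[_ s8] /eqP sb].
  rewrite expr2 -mulrnAr ler_wpM2l// (le_trans (dom _ s8))//.
  by rewrite le_eqVlt /S; apply/orP; left; apply/eqP; apply: eq_bigl => t;
    rewrite oddD sb; case: b {sb}; case: (odd t).
have split (f : nat -> F) : \sum_(0 <= r < 8) f r =
    \sum_(0 <= r < 8 | odd r == true) f r + \sum_(0 <= r < 8 | odd r == false) f r.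
  rewrite (bigID odd)/=; congr (_ + _); apply: eq_bigl => r; by case: odd.
rewrite !split -!/(S _).
apply: le_trans (_ : S true * S false *+ 4 <= _); last first.
  rewrite real_leif_AGM2_scaled// ger0_real// sumr_ge0//.
have := lerD (sq true) (sq false).
set X := \sum_(_ <= _ < _ | _ == true) _; set Y := \sum_(_ <= _ < _ | _ == false) _.
rewrite -mulr2n -mulrnDl => /(ler_wMn2r 2) XY.
rewrite (_ : 4 * _ = (X + Y) *+ 2 *+ 2); last by ring.
by rewrite (le_trans XY)// -!mulrnA.
Qed.

Lemma cauchy_schwarz_nneg (f g : nat -> F) m :
  (forall r, 0 <= f r) -> (forall r, 0 <= g r) ->
  (\sum_(0 <= r < m) f r * g r) ^+ 2 <=
  (\sum_(0 <= r < m) f r ^+ 2) * (\sum_(0 <= r < m) g r ^+ 2).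
Proof.
move=> f0 g0; elim: m => [|m IH]; first by rewrite !big_geq// mul0r expr0n.
rewrite !big_nat_recr//=; move: IH.
set A := \sum_(0 <= r < m) f r * g r; set B := \sum_(0 <= r < m) f r ^+ 2.
set C := \sum_(0 <= r < m) g r ^+ 2 => IH.
have A0 : 0 <= A by rewrite sumr_ge0// => r _; rewrite mulr_ge0.
have B0 : 0 <= B by rewrite sumr_ge0// => r _; rewrite exprn_ge0.
have C0 : 0 <= C by rewrite sumr_ge0// => r _; rewrite exprn_ge0.
(* The square of the left side is 4 (f g)^2 A^2, at most 4 (B g^2)(f^2 C) by the induction
   hypothesis; AM-GM concludes. *)
have am : A * (f m * g m) *+ 2 <= B * g m ^+ 2 + f m ^+ 2 * C.
  rewrite -ler_sqr ?nnegrE; last first.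
  - by rewrite addr_ge0// mulr_ge0// exprn_ge0.
  - by rewrite mulrn_wge0// !mulr_ge0.
  apply: le_trans (_ : (B * g m ^+ 2) * (f m ^+ 2 * C) *+ 4 <= _); last first.
    by rewrite real_leif_AGM2_scaled// ger0_real// mulr_ge0// exprn_ge0.
  rewrite [leLHS](_ : _ = (f m * g m) ^+ 2 *+ 4 * A ^+ 2); last by ring.
  rewrite [leRHS](_ : _ = (f m * g m) ^+ 2 *+ 4 * (B * C)); last by ring.
  by rewrite ler_wpM2l// mulrn_wge0// exprn_ge0// mulr_ge0.
rewrite sqrrD.
rewrite [leRHS](_ : _ = B * C + (B * g m ^+ 2 + f m ^+ 2 * C) + (f m * g m) ^+ 2).
  by rewrite lerD2r lerD.
by ring.
Qed.

Definition tfixed n x := forall k, (bstart n <= k < bstart n.+1)%N ->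
  \sum_(bstart n <= l < bstart n.+1) tproj n k l * x l = x k.

Lemma bstart_child n i r : (bstart n <= i < bstart n.+1)%N -> (r < 8)%N ->
  (bstart n.+1 <= (8 * i + r).+1 < bstart n.+2)%N.
Proof. by rewrite !bstartS; lia. Qed.

(** In P^(n+1) = P (x) Q with Q = P^(n), the identity (I (x) Q)(P (x) Q) = P (x) Q makes Q fix each
    slice with constant last digit [r]. *)
Lemma tfixed_slice n x r : (r < 8)%N -> tfixed n.+1 x ->
  tfixed n (fun i => x (8 * i + r).+1).
Proof.
move=> r8 xP i iB; rewrite -[RHS]xP ?bstart_child// big_block.
transitivity (\sum_(bstart n <= l < bstart n.+1) \sum_(bstart n <= j < bstart n.+1)
  \sum_(0 <= s < 8) tproj n i l * (hproj r s * tproj n l j) * x (8 * j + s).+1).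
  apply: eq_big_nat => l lB.
  rewrite -xP ?bstart_child// big_block mulr_sumr; apply: eq_bigr => j _.
  rewrite mulr_sumr; apply: eq_big_nat => s /andP[_ s8].
  by rewrite tprojS// mulrA.
rewrite exchange_big; apply: eq_bigr => j _; rewrite exchange_big.
apply: eq_big_nat => s /andP[_ s8].
rewrite tprojS// -tproj_idem mulr_sumr mulr_suml; apply: eq_bigr => l _.
by ring.
Qed.

(** Dually, (P (x) I)(P (x) Q) = P (x) Q, so P fixes the vector formed by the eight children of
    [i]. *)
Lemma tfixed_fiber n x i : (bstart n <= i < bstart n.+1)%N -> tfixed n.+1 x ->
  forall r, (r < 8)%N ->
    \sum_(0 <= s < 8) hproj r s * x (8 * i + s).+1 = x (8 * i + r).+1.
Proof.
move=> iB xP r r8; rewrite -[RHS]xP ?bstart_child// big_block.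
transitivity (\sum_(0 <= t < 8) \sum_(bstart n <= j < bstart n.+1)
  \sum_(0 <= s < 8) hproj r t * (hproj t s * tproj n i j) * x (8 * j + s).+1).
  apply: eq_big_nat => t /andP[_ t8].
  rewrite -xP ?bstart_child// big_block mulr_sumr; apply: eq_bigr => j _.
  rewrite mulr_sumr; apply: eq_big_nat => s /andP[_ s8].
  by rewrite tprojS// mulrA.
rewrite exchange_big; apply: eq_bigr => j _; rewrite exchange_big.
apply: eq_big_nat => s /andP[_ s8].
rewrite tprojS// -hproj_idem// !mulr_suml; apply: eq_bigr => t _.
by ring.
Qed.

(** Induction on [n]: the hypothesis applied to each slice leaves 4 sum_r (sum_i |x_ir|)^2, which is
    expanded over pairs (i, j) of fibers and bounded pair by pair. *)
Lemma tfixed_norm n x : tfixed n x ->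
  4 ^+ n * \sum_(bstart n <= k < bstart n.+1) `|x k| ^+ 2 <=
  (\sum_(bstart n <= k < bstart n.+1) `|x k|) ^+ 2.
Proof.
elim: n x => [|n IH] x xP; first by rewrite !big_nat1 mul1r.
rewrite !big_block exprS -mulrA.
pose a i : F := \sum_(0 <= r < 8) `|x (8 * i + r).+1|.
pose q i : F := \sum_(0 <= r < 8) `|x (8 * i + r).+1| ^+ 2.
have a0 i : 0 <= a i by rewrite sumr_ge0.
(* Cauchy-Schwarz over [r], then [hfixed_norm] on both fibers: the square of the left side is at
   most (4 q_i)(4 q_j) <= (a_i a_j)^2. *)
have aa i j : (bstart n <= i < bstart n.+1)%N -> (bstart n <= j < bstart n.+1)%N ->
    4 * (\sum_(0 <= r < 8) `|x (8 * i + r).+1| * `|x (8 * j + r).+1|) <= a i * a j.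
  move=> iB jB; rewrite -ler_sqr ?nnegrE ?mulr_ge0//; last first.
    by rewrite sumr_ge0// => r _; rewrite mulr_ge0.
  have := hfixed_norm (tfixed_fiber iB xP).
  have := hfixed_norm (tfixed_fiber jB xP).
  rewrite -/(a i) -/(a j) -/(q i) -/(q j) => qj qi.
  apply: le_trans (_ : (4 * q i) * (4 * q j) <= _); last first.
    rewrite exprMn; apply: ler_pM => //.
    - by rewrite mulr_ge0// sumr_ge0// => r _; rewrite exprn_ge0.
    - by rewrite mulr_ge0// sumr_ge0// => r _; rewrite exprn_ge0.
  rewrite [leRHS](_ : _ = 4 ^+ 2 * (q i * q j)); last by ring.
  by rewrite exprMn ler_wpM2l// cauchy_schwarz_nneg.
rewrite exchange_big/= mulr_sumr.
apply: le_trans (_ : 4 * \sum_(0 <= r < 8)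
    (\sum_(bstart n <= i < bstart n.+1) `|x (8 * i + r).+1|) ^+ 2 <= _).
  rewrite ler_wpM2l//; apply: ler_sum_nat => r /andP[_ r8].
  exact: IH (tfixed_slice r8 xP).
rewrite [leRHS]expr2 mulr_suml.
have -> : 4 * \sum_(0 <= r < 8)
    (\sum_(bstart n <= i < bstart n.+1) `|x (8 * i + r).+1|) ^+ 2 =
  \sum_(bstart n <= i < bstart n.+1) \sum_(bstart n <= j < bstart n.+1)
    4 * (\sum_(0 <= r < 8) `|x (8 * i + r).+1| * `|x (8 * j + r).+1|).
  under [RHS]eq_bigr => i _ do rewrite -mulr_sumr exchange_big.
  rewrite -[RHS]mulr_sumr exchange_big; congr (_ * _); apply: eq_bigr => r _.
  by rewrite expr2 mulr_suml; apply: eq_bigr => i _; rewrite mulr_sumr.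
apply: ler_sum_nat => i iB.
rewrite mulr_sumr; apply: ler_sum_nat => j jB.
exact: aa.
Qed.

End TensorProjection.

(** * Hermitian forms and nonnegative limits *)

Lemma big_nat_blocks (V : nmodType) N (f : nat -> V) :
  \sum_(0 <= k < bstart N) f k =
  \sum_(0 <= n < N) \sum_(bstart n <= k < bstart n.+1) f k.
Proof.
elim: N => [|N IH]; first by rewrite !big_geq.
by rewrite [RHS]big_nat_recr//= -IH -big_cat_nat//= bstart_mono.
Qed.

Section HermitianForms.
Variables (F : numFieldType) (cj : {rmorphism F -> F}).
Hypothesis mul_cj : forall a, a * cj a = `|a| ^+ 2.
Implicit Types (x y : nat -> F) (n : nat).

Lemma tproj_cj n k l : cj (tproj F n k l) = tproj F n k l.
Proof.
elim: n k l => [|n IH] k l /=; first by rewrite rmorph_nat.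
by rewrite rmorphM IH /hproj fmorph_div rmorph_int rmorph_nat.
Qed.

Lemma norm_cj a : `|cj a| = `|a|.
Proof.
have [->|a0] := eqVneq a 0; first by rewrite rmorph0.
apply: (@mulfI _ `|a|); first by rewrite normr_eq0.
by rewrite -normrM mul_cj expr2 normrM normr_id.
Qed.

Lemma normsq_sum_cj (m p : nat) (q : nat -> F) x :
  (forall j, cj (q j) = q j) ->
  `|\sum_(m <= j < p) q j * x j| ^+ 2 =
  \sum_(m <= j < p) \sum_(m <= l < p) q j * q l * (x j * cj (x l)).
Proof.
move=> hq; rewrite -mul_cj rmorph_sum mulr_suml; apply: eq_bigr => j _.
rewrite mulr_sumr; apply: eq_bigr => l _.
by rewrite rmorphM hq; ring.
Qed.

Definition tform n x y : F :=
  \sum_(bstart n <= k < bstart n.+1) \sum_(bstart n <= l < bstart n.+1)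
    tproj F n k l * x l * cj (y k).

Lemma tformE n x y : tform n x y =
  \sum_(bstart n <= k < bstart n.+1) \sum_(bstart n <= l < bstart n.+1)
    x k * cj (tproj F n k l * y l).
Proof.
rewrite /tform exchange_big; apply: eq_bigr => k _; apply: eq_bigr => l _.
by rewrite rmorphM tproj_cj tprojC; ring.
Qed.

(** By symmetry and idempotence <P x, x> = ||P x||^2 on the block. *)
Lemma tform_ge0 n x : 0 <= tform n x x.
Proof.
suff -> : tform n x x = \sum_(bstart n <= j < bstart n.+1)
    `|\sum_(bstart n <= l < bstart n.+1) tproj F n j l * x l| ^+ 2.
  by apply: sumr_ge0 => j _; rewrite exprn_ge0.
under [RHS]eq_bigr => j _.
  rewrite (normsq_sum_cj _ _ _ (tproj_cj n j)); over.
rewrite /tform [LHS]exchange_big [RHS]exchange_big; apply: eq_bigr => l _.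
rewrite [RHS]exchange_big; apply: eq_bigr => k _.
rewrite -[in LHS]tproj_idem !mulr_suml; apply: eq_bigr => j _.
by rewrite [tproj F n k j]tprojC; ring.
Qed.

Definition tdefect n x k : F :=
  x k - \sum_(bstart n <= l < bstart n.+1) tproj F n k l * x l.

(** Expanding the square makes it linear in the rank-one matrix with entries x_j cj(x_l), hence
    summable over the terms of a decomposition. *)
Lemma tdefect_normsq n x k : (bstart n <= k < bstart n.+1)%N ->
  `|tdefect n x k| ^+ 2 =
  \sum_(bstart n <= j < bstart n.+1) \sum_(bstart n <= l < bstart n.+1)
    ((k == j)%:R - tproj F n k j) * ((k == l)%:R - tproj F n k l)
    * (x j * cj (x l)).
Proof.
move=> kB; rewrite -normsq_sum_cj; last first.
  by move=> j; rewrite rmorphB tproj_cj rmorph_nat.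
congr (`|_| ^+ 2); rewrite /tdefect.
under [RHS]eq_bigr do rewrite mulrBl.
rewrite sumrB; congr (_ - _).
rewrite (bigD1_seq k)/= ?mem_index_iota ?iota_uniq// eqxx mul1r big1 ?addr0//.
by move=> j /negPf jk; rewrite eq_sym jk mul0r.
Qed.

(** The left side is the (k, k) entry of (I - P) P (I - P), with P the n-th tensor power. *)
Lemma tproj_defect n k : (bstart n <= k < bstart n.+1)%N ->
  \sum_(bstart n <= j < bstart n.+1) \sum_(bstart n <= l < bstart n.+1)
    ((k == j)%:R - tproj F n k j) * ((k == l)%:R - tproj F n k l)
    * tproj F n j l = 0.
Proof.
move=> kB; rewrite big1// => j _.
under eq_bigr => l _ do rewrite -mulrA.
rewrite -mulr_sumr; apply/eqP; rewrite mulf_eq0; apply/orP; right.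
under eq_bigr do rewrite mulrBl [tproj F n j _]tprojC.
rewrite sumrB tproj_idem (bigD1_seq k)/= ?mem_index_iota ?iota_uniq//.
rewrite eqxx mul1r big1 ?addr0 ?subrr//.
by move=> l /negPf lk; rewrite eq_sym lk mul0r.
Qed.

End HermitianForms.

Section NonnegLimits.
Variable F : numFieldType.

(** The order of [F] may be partial, as on the complex numbers; being nonnegative means being equal
    to one's norm, which survives limits by continuity. *)
Lemma numField_limn_ge0 (u : nat -> F) (l : F) :
  (forall n, 0 <= u n) -> u @ \oo --> l -> 0 <= l.
Proof.
move=> u0 ul; rewrite (_ : l = `|l|)//.
have := @cvg_norm F F _ _ (eventually_filter : Filter \oo) _ _ ul.
rewrite (_ : (fun n => `|u n|) = u); last by apply/funext => n; rewrite ger0_norm.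
by move=> h; apply: (@cvg_unique F (@norm_hausdorff F F) (u @ \oo) _ l `|l| ul h).
Qed.


Lemma nonneg_series_le (u : nat -> F) (l : F) N :
  (forall n, 0 <= u n) -> series u @ \oo --> l -> \sum_(0 <= k < N) u k <= l.
Proof.
move=> u0 ul; rewrite -subr_ge0.
pose v n := \sum_(N <= k < n + N) u k.
apply: (@numField_limn_ge0 v) => [n|]; first exact: sumr_ge0.
rewrite (_ : v = (fun n => series u (n + N)%N - \sum_(0 <= k < N) u k)).
  by apply: cvgB; [rewrite cvg_shiftn|exact: cvg_cst].
apply/funext => n; rewrite /v /series/= [in RHS](@big_cat_nat _ _ _ N)//= ?leq_addl//.
by rewrite [RHS]addrAC subrr add0r.
Qed.

Lemma cvg_bstart (u : nat -> F) (l : F) :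
  u @ \oo --> l -> (fun N => u (bstart N)) @ \oo --> l.
Proof.
move=> ul; apply: cvg_comp ul; apply/cvgnyPge => A.
by near=> N; apply: leq_trans (leq_bstart _); near: N; exact: nbhs_infty_ge.
Unshelve. all: by end_near. Qed.

End NonnegLimits.

(** * Coordinates and norms in l_2 *)

Section Ell2Facts.
Variables (R : realType) (K : scalars R).
Implicit Types (a b : K) (x y : ell2 K) (N : nat).

Lemma sabs_eq0 a : sabs a = 0 -> a = 0.
Proof. by move=> a0; apply/eqP; rewrite -normr_eq0 sabsE a0 rmorph0. Qed.

Lemma ler_sabs_sum (u : nat -> K) m n :
  sabs (\sum_(m <= k < n) u k) <= \sum_(m <= k < n) sabs (u k).
Proof.
rewrite -(sembed_le K) -sabsE rmorph_sum.
by apply: le_trans (ler_norm_sum _ _ _) _; apply: ler_sum => i _; rewrite sabsE.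
Qed.

(** The topology of [K] quantifies over positive [e] in [K]; such an [e] is the image of the real
    number [sabs e], to which the real limit applies. *)
Lemma sabs_cvg (u : nat -> K) (l : K) :
  (fun n => sabs (u n - l)) @ \oo --> (0 : R) -> u @ \oo --> l.
Proof.
move=> /cvgrPdist_lt ul; apply/cvgrPdist_lt => e e0.
have e0' : 0 < sabs e.
  by rewrite lt_neqAle sabs_ge0 andbT eq_sym; apply: contraTneq e0 => /sabs_eq0 ->;
    rewrite ltxx.
have := ul _ e0'; apply: filterS => n /=.
rewrite sub0r normrN ger0_norm ?sabs_ge0// => une.
rewrite distrC -(gtr0_norm e0) !sabsE lt_neqAle sembed_le ltW// andbT.
by rewrite (inj_eq (@sembed_inj _ K)) lt_eqF.
Qed.

Lemma seq_sqnorm2_lty x : (seq_sqnorm2 x < +oo)%E.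
Proof. by case: x => x /=; rewrite inE. Qed.

Lemma seq_sqnorm2_ge0 (x : nat -> K) : (0 <= seq_sqnorm2 x)%E.
Proof.
by apply: nneseries_ge0 => k _ _; rewrite lee_fin exprn_ge0 ?sabs_ge0.
Qed.

Lemma norm2_ge0 x : 0 <= norm2 x. Proof. exact: sqrtr_ge0. Qed.

Lemma norm2_sqE x : (norm2 x ^+ 2)%:E = seq_sqnorm2 x.
Proof.
rewrite sqr_sqrtr ?fine_ge0 ?seq_sqnorm2_ge0// fineK//.
by rewrite ge0_fin_numE ?seq_sqnorm2_ge0// seq_sqnorm2_lty.
Qed.

Lemma sum_sabs_le_norm2 x N : \sum_(0 <= k < N) sabs (x k : K) ^+ 2 <= norm2 x ^+ 2.
Proof.
rewrite -lee_fin norm2_sqE -sumEFin; apply: nneseries_lim_ge => k _ _.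
by rewrite lee_fin exprn_ge0 ?sabs_ge0.
Qed.

Lemma sabs_le_norm2 x k : sabs (x k : K) <= norm2 x.
Proof.
rewrite -(@ler_pXn2r _ 2)// ?nnegrE ?sabs_ge0 ?norm2_ge0//.
apply: le_trans (sum_sabs_le_norm2 x k.+1).
by rewrite big_nat_recr//= lerDr sumr_ge0// => i _; rewrite exprn_ge0 ?sabs_ge0.
Qed.

Lemma seq_sqnorm2_le (x : nat -> K) (M : R) :
  (forall N, \sum_(0 <= k < N) sabs (x k) ^+ 2 <= M) -> (seq_sqnorm2 x <= M%:E)%E.
Proof.
move=> xM; apply: lime_le.
  by apply: is_cvg_nneseries => k _ _; rewrite lee_fin exprn_ge0 ?sabs_ge0.
by near=> N; rewrite sumEFin lee_fin.
Unshelve. all: by end_near. Qed.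

Lemma seq_norm1_ge0 (x : nat -> K) : (0 <= seq_norm1 x)%E.
Proof. by apply: nneseries_ge0 => k _ _; rewrite lee_fin sabs_ge0. Qed.

Lemma sum_sabs_le_norm1 (x : nat -> K) m n : (seq_norm1 x < +oo)%E ->
  \sum_(m <= k < n) sabs (x k) <= fine (seq_norm1 x).
Proof.
move=> x1; have x0 := seq_norm1_ge0 x.
apply: le_trans (_ : \sum_(0 <= k < n) sabs (x k) <= _).
  have [mn|/ltnW nm] := leqP m n; last first.
    by rewrite big_geq// sumr_ge0// => i _; rewrite sabs_ge0.
  rewrite [leRHS](@big_cat_nat _ _ _ m)//= lerDr sumr_ge0// => i _.
  by rewrite sabs_ge0.
rewrite -lee_fin fineK ?ge0_fin_numE// -sumEFin.
by apply: nneseries_lim_ge => k _ _; rewrite lee_fin sabs_ge0.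
Qed.

Lemma norm2_cvg_coord (u : nat -> ell2 K) k :
  (fun n => norm2 (u n)) @ \oo --> (0 : R) -> (fun n => u n k : K) @ \oo --> (0 : K).
Proof.
move=> u0; apply: sabs_cvg; apply: squeeze_cvgr u0; last exact: cvg_cst.
by near=> n; rewrite subr0 sabs_ge0 sabs_le_norm2.
Unshelve. all: by end_near. Qed.

Lemma ell2_addE x y k : (x + y) k = x k + y k. Proof. by []. Qed.
Lemma ell2_scaleE a x k : (a *: x) k = a * x k :> K. Proof. by []. Qed.

Lemma ell2_sumE (u : nat -> ell2 K) N k :
  (\sum_(0 <= m < N) u m : ell2 K) k = \sum_(0 <= m < N) (u m k : K).
Proof.
elim: N => [|N IH]; first by rewrite !big_geq.
by rewrite [RHS]big_nat_recr// -IH big_nat_recr.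
Qed.

Lemma series_eventually_const (u : nat -> K) j :
  (forall k, k != j -> u k = 0) -> series u @ \oo --> u j.
Proof.
move=> uj; apply: (@cvg_near_cst _ _ (u j)); near=> N.
rewrite /series/= (bigD1_seq j)/= ?iota_uniq//; last first.
  by rewrite mem_index_iota/=; near: N; exact: nbhs_infty_gt.
by rewrite big1 ?addr0.
Unshelve. all: by end_near. Qed.

End Ell2Facts.

(** * The block-diagonal operator *)

Section Operator.
Variables (R : realType) (K : scalars R).
Implicit Types (x y : ell2 K) (k l n N : nat).

(** The base 14 lies strictly between 12, the growth of the entry sums, and 16 = 4 * 4, the growth
    of the trace times the l_1 gain. *)
Definition block_weight n : K := 14^-1 ^+ n.

Definition block_entry k l : K :=
  if level l == level k then block_weight (level k) * tproj K (level k) k l else 0.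

(** Row [k] meets only its own block, so the sum is finite and makes sense for arbitrary
    sequences. *)
Definition block_op_seq (x : nat -> K^o) : nat -> K^o := fun k =>
  \sum_(bstart (level k) <= l < bstart (level k).+1) block_entry k l * x l.

Lemma block_entryE n k l :
  (bstart n <= k < bstart n.+1)%N -> (bstart n <= l < bstart n.+1)%N ->
  block_entry k l = block_weight n * tproj K n k l.
Proof. by rewrite /block_entry => /level_eq -> /level_eq ->; rewrite eqxx. Qed.

Definition block_row k : R :=
  \sum_(bstart (level k) <= l < bstart (level k).+1) sabs (block_entry k l).

Lemma block_row_ge0 k : 0 <= block_row k.
Proof. by apply: sumr_ge0 => l _; exact: sabs_ge0. Qed.

Lemma block_row_block n :
  \sum_(bstart n <= k < bstart n.+1) block_row k = (6 / 7) ^+ n.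
Proof.
apply: (sembed_inj (K := K)); rewrite rmorph_sum rmorphXn fmorph_div !rmorph_nat.
rewrite (_ : 6 / 7 = 14^-1 * 12); last by field.
rewrite exprMn -tproj_norm mulr_sumr; apply: eq_big_nat => k kB.
rewrite rmorph_sum mulr_sumr (level_eq kB); apply: eq_big_nat => l lB.
by rewrite -sabsE (block_entryE kB lB) normrM /block_weight normrX normfV normr_nat.
Qed.

(** The geometric series of ratio 12/14 = 6/7 sums to 7; this one constant serves for the operator
    norm and for [norm11]. *)
Lemma sum_block_row_le N : \sum_(0 <= k < N) block_row k <= 7.
Proof.
apply: le_trans (_ : \sum_(0 <= k < bstart N) block_row k <= _).
  rewrite [leRHS](@big_cat_nat _ _ _ N)//= ?leq_bstart// lerDl sumr_ge0// => i _.
  exact: block_row_ge0.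
rewrite big_nat_blocks (eq_bigr (fun n => (6 / 7) ^+ n)); last first.
  by move=> n _; exact: block_row_block.
suff -> : \sum_(0 <= n < N) (6 / 7) ^+ n = 7 - 7 * (6 / 7) ^+ N :> R.
  by rewrite gerBl mulr_ge0// exprn_ge0// divr_ge0.
elim: N => [|N IH]; first by rewrite big_geq// expr0; ring.
by rewrite big_nat_recr//= IH exprS; field.
Qed.

Lemma block_row_le k : block_row k <= 7.
Proof.
apply: le_trans (sum_block_row_le k.+1).
by rewrite big_nat_recr//= lerDr sumr_ge0// => i _; exact: block_row_ge0.
Qed.

Lemma sabs_block_op_le (x : nat -> K) (M : R) k : (forall l, sabs (x l) <= M) ->
  sabs (block_op_seq x k : K) <= block_row k * M.
Proof.
move=> xM; apply: le_trans (ler_sabs_sum _ _ _) _.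
rewrite mulr_suml; apply: ler_sum => l _.
by rewrite sabsM ler_wpM2l// sabs_ge0.
Qed.

(** Coordinates of x are at most ||x||_2, so |(A x)_k| <= row_k ||x||_2; then row_k^2 <= 7 row_k,
    and the rows sum to at most 7. *)
Lemma block_op_sqnorm_le x : (seq_sqnorm2 (block_op_seq x) <= ((7 * norm2 x) ^+ 2)%:E)%E.
Proof.
apply: seq_sqnorm2_le => N.
apply: le_trans (_ : \sum_(0 <= k < N) block_row k * (7 * norm2 x ^+ 2) <= _).
  apply: ler_sum => k _.
  apply: le_trans (_ : (block_row k * norm2 x) ^+ 2 <= _).
    rewrite ler_pXn2r ?nnegrE ?sabs_ge0 ?mulr_ge0 ?block_row_ge0 ?norm2_ge0//.
    by apply: sabs_block_op_le => l; exact: sabs_le_norm2.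
  rewrite exprMn expr2 -mulrA ler_wpM2l ?block_row_ge0// ler_wpM2r ?block_row_le//.
  by rewrite exprn_ge0 ?norm2_ge0.
rewrite -mulr_suml exprMn [_ ^+ 2 in leRHS]expr2 -[leRHS]mulrA.
by rewrite ler_wpM2r ?sum_block_row_le// mulr_ge0// exprn_ge0 ?norm2_ge0.
Qed.

Lemma block_op_subproof x : block_op_seq x \in @ell2_pred R K.
Proof. by rewrite inE /=; apply: le_lt_trans (block_op_sqnorm_le x) (ltry _). Qed.

Definition block_op x : ell2 K := Ell2 (block_op_subproof x).

Lemma block_op_is_linear : linear block_op.
Proof.
move=> a x y; apply: val_inj; apply/funext => k.
change (block_op_seq (a *: x + y) k = a * block_op_seq x k + block_op_seq y k :> K).
rewrite /block_op_seq mulr_sumr -big_split.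
apply: eq_bigr => l _.
by rewrite ell2_addE ell2_scaleE mulrDr mulrCA.
Qed.

HB.instance Definition _ := 
  GRing.isLinear.Build K (ell2 K) (ell2 K) *:%R block_op block_op_is_linear.

Lemma block_op_bounded : bounded_op block_op.
Proof.
exists 7 => x; rewrite -(@ler_pXn2r _ 2)// ?nnegrE ?mulr_ge0 ?norm2_ge0//.
by rewrite -lee_fin norm2_sqE block_op_sqnorm_le.
Qed.

Lemma block_op_block n k x : (bstart n <= k < bstart n.+1)%N ->
  block_op x k = block_weight n * \sum_(bstart n <= l < bstart n.+1) tproj K n k l * x l :> K.
Proof.
move=> kB; rewrite /= /block_op_seq (level_eq kB) mulr_sumr; apply: eq_big_nat => l lB.
by rewrite (block_entryE kB lB) mulrA.
Qed.

Lemma block_op_delta k l : block_op (delta K l) k = block_entry k l :> K.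
Proof.
rewrite /= /block_op_seq /delta_seq.
have [lB|lB] := boolP (bstart (level k) <= l < bstart (level k).+1)%N.
  rewrite (bigD1_seq l)/= ?mem_index_iota ?iota_uniq// eqxx mulr1 big1 ?addr0//.
  by move=> j /negPf ->; rewrite mulr0.
rewrite /block_entry ifN; last first.
  by apply: contra lB => /eqP <-; exact: bstart_level.
rewrite big_nat_cond big1// => j /andP[jB _].
have /negPf -> : j != l by apply: contraNneq lB => <-.
by rewrite mulr0.
Qed.

Lemma block_entryC k l : block_entry k l = block_entry l k.
Proof. by rewrite /block_entry eq_sym; case: eqP => // ->; rewrite tprojC. Qed.

End Operator.

Lemma mul_le_addsqr (F : realDomainType) (a b : F) : 0 <= a -> 0 <= b ->
  a * b <= a ^+ 2 + b ^+ 2.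
Proof.
move=> a0 b0; rewrite -subr_ge0 (_ : _ - _ = (a - b) ^+ 2 + a * b); last by ring.
by rewrite addr_ge0 ?sqr_ge0// mulr_ge0.
Qed.

(** * Scalars with a conjugation: membership of the operator in [Gamma] *)

Section Construction.
Variables (R : realType) (K : scalars R) (cj : {rmorphism K -> K}).
Hypothesis sconjE : forall a : K, sconj a = cj a.
Hypothesis mul_cj : forall a : K, a * cj a = `|a| ^+ 2.
Hypothesis abs_summable_cvg : forall u : nat -> K,
  (exists M : R, forall N, \sum_(0 <= k < N) sabs (u k) <= M) -> cvgn (series u).
Implicit Types (x y : ell2 K) (k l n N : nat).

(** [inner] is a [lim], informative only once convergence is known; that follows from |x_k y_k| <=
    |x_k|^2 + |y_k|^2. *)
Lemma inner_cvg x y : series (fun k => (x k : K) * sconj (y k : K)) @ \oo --> inner x y.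
Proof.
apply: abs_summable_cvg; exists (norm2 x ^+ 2 + norm2 y ^+ 2) => N.
apply: le_trans (lerD (sum_sabs_le_norm2 x N) (sum_sabs_le_norm2 y N)).
rewrite -big_split; apply: ler_sum => k _.
have -> : sabs ((x k : K) * sconj (y k : K)) = sabs (x k : K) * sabs (y k : K).
  by apply: (sembed_inj (K := K)); rewrite rmorphM -!sabsE normrM sconjE norm_cj.
exact: (mul_le_addsqr (sabs_ge0 _) (sabs_ge0 _)).
Qed.

Lemma inner_cvg_unique x y (c : K) :
  series (fun k => (x k : K) * sconj (y k : K)) @ \oo --> c -> inner x y = c.
Proof. by move=> h; apply: cvg_lim h; exact: (@norm_hausdorff K K). Qed.

Lemma inner_delta x k : inner x (delta K k) = x k.
Proof.
have -> : x k = (x k : K) * sconj (delta K k k : K) :> K.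
  by rewrite sconjE /= /delta_seq eqxx rmorph1 mulr1.
apply: inner_cvg_unique.
apply: (@series_eventually_const R K (fun j => (x j : K) * sconj (delta K k j : K))).
by move=> j /negPf jk; rewrite sconjE /= /delta_seq jk rmorph0 mulr0.
Qed.

Lemma inner_delta_l x k : inner (delta K k) x = cj (x k).
Proof.
have -> : cj (x k) = (delta K k k : K) * sconj (x k : K) :> K.
  by rewrite sconjE /= /delta_seq eqxx mul1r.
apply: inner_cvg_unique.
apply: (@series_eventually_const R K (fun j => (delta K k j : K) * sconj (x j : K))).
by move=> j /negPf jk; rewrite sconjE /= /delta_seq jk mul0r.
Qed.

(** Partial sums read at block boundaries consist of whole blocks; symmetry and positivity of the
    block forms then pass to the limit. *)
Lemma inner_block_op_cvg x y :
  (fun N => \sum_(0 <= n < N) block_weight K n * tform cj n x y) @ \oo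
    --> inner (block_op x) y.
Proof.
rewrite [X in X @ _ --> _](_ : _ = fun N =>
    series (fun k => (block_op x k : K) * sconj (y k : K)) (bstart N)).
  exact: (@cvg_bstart K _ _ (@inner_cvg (block_op x) y)).
apply/funext => N; rewrite /series/= big_nat_blocks; apply: eq_bigr => n _.
rewrite /tform mulr_sumr; apply: eq_big_nat => k kB.
by rewrite sconjE -[block_op_seq x k]/(block_op x k) (block_op_block x kB) -mulrA mulr_suml.
Qed.

Lemma block_weight_ge0 n : 0 <= block_weight K n.
Proof. by rewrite exprn_ge0// invr_ge0. Qed.

Lemma block_weight_cj n : cj (block_weight K n) = block_weight K n.
Proof. by rewrite rmorphXn fmorphV rmorph_nat. Qed.

Lemma block_op_self_adjoint : self_adjoint (@block_op R K).
Proof.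
move=> x y.
have xAy : (fun N => \sum_(0 <= n < N) block_weight K n * tform cj n x y) @ \oo
    --> inner x (block_op y).
  rewrite [X in X @ _ --> _](_ : _ = fun N =>
      series (fun k => (x k : K) * sconj (block_op y k : K)) (bstart N)).
    exact: (@cvg_bstart K _ _ (@inner_cvg x (block_op y))).
  apply/funext => N; rewrite /series/= big_nat_blocks; apply: eq_bigr => n _.
  rewrite tformE mulr_sumr; apply: eq_big_nat => k kB.
  rewrite sconjE -[block_op_seq y k]/(block_op y k) (block_op_block y kB) rmorphM block_weight_cj.
  by rewrite mulrCA rmorph_sum -mulr_sumr.
exact: (@cvg_unique K (@norm_hausdorff K K) _ _ _ _ (@inner_block_op_cvg x y) xAy).
Qed.

Lemma block_op_ge0 x : 0 <= inner (block_op x) x.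
Proof.
apply: numField_limn_ge0 (@inner_block_op_cvg x x) => N.
by apply: sumr_ge0 => n _; rewrite mulr_ge0 ?block_weight_ge0// tform_ge0.
Qed.

Lemma sum_sabs_block_entry_le k N : \sum_(0 <= l < N) sabs (block_entry K k l) <= block_row K k.
Proof.
rewrite /block_row; set a := bstart _; set b := bstart _.
have abk : (a <= k < b)%N := bstart_level k.
(* Widening the range to cover the whole block lets it be cut into that block and two stretches of
   zeros. *)
apply: le_trans (_ : \sum_(0 <= l < maxn N b) sabs (block_entry K k l) <= _).
  rewrite [leRHS](@big_cat_nat _ _ _ N)//= ?leq_maxl// lerDl sumr_ge0// => i _.
  exact: sabs_ge0.
rewrite (@big_cat_nat _ _ _ a)//=; last by lia.
rewrite [X in _ + X](@big_cat_nat _ _ _ b)//= ?leq_maxr//; last by lia.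
have out l : ~~ (a <= l < b)%N -> sabs (block_entry K k l) = 0.
  move=> lB; rewrite /block_entry; case: eqP => [lk|_]; last exact: sabs0.
  by move: lB; rewrite /a /b -lk bstart_level.
rewrite big_nat big1 ?add0r => [|l lB]; last by apply: out; lia.
rewrite [X in _ + X]big_nat [X in _ + X]big1 ?addr0// => l lB.
by apply: out; lia.
Qed.

Lemma norm11_block_op : (norm11 (@block_op R K) < +oo)%E.
Proof.
apply: (@le_lt_trans _ _ 7%:E); last exact: ltry.
rewrite /norm11.
under eq_esum do rewrite inner_delta block_op_delta.
(* Over a product set the sum iterates into column sums, which symmetry turns into row sums. *)
rewrite (_ : esum _ _ = \esum_(kl in [set: nat] `*`` (fun=> [set: nat]))
    (sabs (block_entry K kl.2 kl.1))%:E)%E; last first.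
  by congr esum; apply/seteqP; split.
rewrite -(@esum_esum _ _ _ _ _ (fun k l => (sabs (block_entry K l k))%:E)); last first.
  by move=> k l _ _; rewrite lee_fin sabs_ge0.
rewrite -nneseries_esumT; last first.
  by move=> k; apply: esum_ge0 => l _; rewrite lee_fin sabs_ge0.
apply: (@le_trans _ _ (\sum_(0 <= k <oo) (block_row K k)%:E)%E).
  apply: lee_nneseries => k _.
    by rewrite esum_ge0// => l; rewrite lee_fin sabs_ge0.
  rewrite -nneseries_esumT; last by move=> l; rewrite lee_fin sabs_ge0.
  apply: lime_le; first by apply: is_cvg_nneseries => l _ _; rewrite lee_fin sabs_ge0.
  near=> N; rewrite sumEFin lee_fin; under eq_bigr do rewrite block_entryC.
  exact: sum_sabs_block_entry_le.
apply: lime_le; first by apply: is_cvg_nneseries => k _ _; rewrite lee_fin block_row_ge0.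
by near=> N; rewrite sumEFin lee_fin sum_block_row_le.
Unshelve. all: by end_near. Qed.

Lemma block_op_Gamma : Gamma (@block_op R K).
Proof.
split; [exact: block_op_bounded|exact: block_op_self_adjoint|
  exact: block_op_ge0|exact: norm11_block_op].
Qed.

(** * Lower bound on every factorization, and exclusion from [Gamma_plus] *)

Section Factorization.
Variables (x : nat -> ell2 K) (s : R).
Hypothesis x_l1 : forall k, (seq_norm1 (x k) < +oo)%E.
Hypothesis x_sum : strong_sum (fun k => rank_one (x k)) (@block_op R K).
Hypothesis x_le : forall N, \sum_(0 <= m < N) fine (seq_norm1 (x m)) ^+ 2 <= s.

(** Strong convergence is tested on [delta K l] and read at coordinate [j], which the norm
    dominates. *)
Lemma factor_entry_cvg j l :
  series (fun m => (x m j : K) * cj (x m l : K)) @ \oo --> block_entry K j l.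
Proof.
have h := @norm2_cvg_coord R K _ j (x_sum (delta K l)).
rewrite -[block_entry K j l]subr0 -block_op_delta.
rewrite [X in X @ _ --> _](_ : _ = fun N => (block_op (delta K l) j : K) -
    ((block_op (delta K l) - \sum_(0 <= m < N) rank_one (x m) (delta K l)) j : K)).
  by apply: cvgB; [exact: cvg_cst|exact: h].
apply/funext => N.
transitivity ((block_op (delta K l) j : K) - ((block_op (delta K l) j : K) -
  ((\sum_(0 <= m < N) rank_one (x m) (delta K l) : ell2 K) j : K))); last by [].
rewrite opprB addrCA subrr addr0 ell2_sumE; apply: eq_bigr => m _.
by rewrite /rank_one ell2_scaleE inner_delta_l mulrC.
Qed.

Lemma cvg_sum_sum (c L : nat -> nat -> K) (u : nat -> nat -> nat -> K) m n :
  (forall j l, u j l @ \oo --> L j l) ->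
  (fun N => \sum_(m <= j < n) \sum_(m <= l < n) c j l * u j l N) @ \oo -->
  \sum_(m <= j < n) \sum_(m <= l < n) c j l * L j l.
Proof.
move=> uL; apply: cvg_big => [|j _]; first exact: add_continuous.
apply: cvg_big => [|l _]; first exact: add_continuous.
by apply: cvgMl_tmp; exact: uL.
Qed.

(** Summed over all factors, the squared defects at [k] give the (k, k) entry of (I - P) A (I - P)
    on the block, zero because A is there a multiple of P; nonnegative terms with sum 0 vanish. *)
Lemma factor_defect n m k : (bstart n <= k < bstart n.+1)%N ->
  tdefect n (x m : nat -> K) k = 0.
Proof.
move=> kB; pose c j l := ((k == j)%:R - tproj K n k j) * ((k == l)%:R - tproj K n k l).
have lim0 : series (fun m => `|tdefect n (x m : nat -> K) k| ^+ 2) @ \oo --> (0 : K).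
  have <- : \sum_(bstart n <= j < bstart n.+1) \sum_(bstart n <= l < bstart n.+1)
      c j l * block_entry K j l = 0.
    transitivity (block_weight K n * 0); last exact: mulr0.
    rewrite -[X in _ = _ * X](tproj_defect K kB) mulr_sumr.
    apply: eq_big_nat => j jB; rewrite mulr_sumr; apply: eq_big_nat => l lB.
    by rewrite (block_entryE K jB lB) mulrCA.
  rewrite [X in X @ _ --> _](_ : _ = fun N => \sum_(bstart n <= j < bstart n.+1)
      \sum_(bstart n <= l < bstart n.+1)
      c j l * series (fun m => (x m j : K) * cj (x m l : K)) N).
    by apply: cvg_sum_sum => j l; exact: factor_entry_cvg.
  apply/funext => N; rewrite /series/=.
  under eq_bigr do rewrite (tdefect_normsq mul_cj _ kB).
  rewrite exchange_big; apply: eq_bigr => j _.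
  by rewrite exchange_big; apply: eq_bigr => l _; rewrite mulr_sumr.
(* The partial sum of length m + 1 is the first to contain term [m]. *)
have := nonneg_series_le m.+1 _ lim0; rewrite big_nat_recr//= => le0.
have sq0 (y : K) : 0 <= `|y| ^+ 2 by rewrite exprn_ge0.
apply/eqP; rewrite -normr_eq0 -sqrf_eq0 eq_le sq0 andbT.
by apply: le_trans (le0 _) => //; rewrite lerDr sumr_ge0.
Qed.

Lemma factor_ge n : (8 / 7) ^+ n <= s.
Proof.
rewrite -(sembed_le K) -subr_ge0.
(* [S N] is 4^n times the block trace of the first N rank-one terms: at most sum_m ||x_m||_1^2 by
   [tfixed_norm], and tending to 4^n 14^-n 4^n = (8/7)^n. *)
pose S N := 4 ^+ n * \sum_(bstart n <= k < bstart n.+1)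
  series (fun m => (x m k : K) * cj (x m k : K)) N.
apply: (@numField_limn_ge0 K (fun N => sembed K s - S N)).
  move=> N; rewrite subr_ge0.
  apply: le_trans (_ : sembed K (\sum_(0 <= m < N) fine (seq_norm1 (x m)) ^+ 2) <= _);
    last by rewrite sembed_le.
  rewrite rmorph_sum /S /series/= exchange_big mulr_sumr; apply: ler_sum => m _.
  apply: le_trans (_ : (\sum_(bstart n <= k < bstart n.+1) `|x m k : K|) ^+ 2 <= _).
    rewrite (eq_bigr (fun k => `|x m k : K| ^+ 2)); last first.
      by move=> k _; exact: mul_cj.
    apply: tfixed_norm => k kB; apply/eqP; rewrite eq_sym -subr_eq0.
    by rewrite -[_ - _]/(tdefect n (x m : nat -> K) k) factor_defect.
  rewrite rmorphXn lerXn2r ?nnegrE ?sumr_ge0//.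
    by rewrite -(rmorph0 (sembed K)) sembed_le fine_ge0// seq_norm1_ge0.
  under eq_bigr do rewrite sabsE.
  by rewrite -rmorph_sum sembed_le sum_sabs_le_norm1.
apply: cvgB; first exact: cvg_cst.
rewrite (_ : sembed K _ = 4 ^+ n * \sum_(bstart n <= k < bstart n.+1) block_entry K k k).
  apply: cvgMl_tmp; apply: cvg_big => [|k _]; first exact: add_continuous.
  exact: factor_entry_cvg.
rewrite (eq_big_nat _ _ (F2 := fun k => block_weight K n * tproj K n k k)); last first.
  by move=> k kB; rewrite (block_entryE K kB kB).
rewrite -mulr_sumr tproj_trace rmorphXn fmorph_div !rmorph_nat /block_weight -!exprMn.
by congr (_ ^+ _); field.
Qed.

End Factorization.

Lemma exp_8_7_unbounded (s : R) : exists n, s < (8 / 7) ^+ n.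
Proof.
(* Bernoulli's inequality for (1 + 1/7)^n; the factor 7 in the witness below cancels the division by
   7. *)
have bern n : 1 + n%:R / 7 <= (8 / 7) ^+ n :> R.
  elim: n => [|n IH]; first by rewrite mul0r addr0 expr0.
  rewrite exprS; apply: (@le_trans _ _ (8 / 7 * (1 + n%:R / 7))); last first.
    by rewrite ler_wpM2l// divr_ge0.
  rewrite -natr1; set t : R := n%:R; have t0 : 0 <= t by exact: ler0n.
  by lra.
exists (7 * Num.bound `|s|)%N; apply: lt_le_trans (bern _).
rewrite natrM mulrC mulKf//; apply: le_lt_trans (ler_norm s) _.
by apply: lt_trans (archi_boundP (normr_ge0 s)) _; rewrite ltrDr.
Qed.

(** A finite infimum yields one factorization with finite sum, whose real value would bound (8/7)^n
    for every n. *)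
Lemma block_op_not_Gamma_plus : ~ Gamma_plus (@block_op R K).
Proof.
move=> [_ /ereal_inf_lt[_ [x [x1 xA ->]] sfin]].
have sq0 k : (0 <= seq_norm1 (x k) ^+ 2)%E by rewrite expe_ge0// seq_norm1_ge0.
have s0 : (0 <= \sum_(0 <= k <oo) seq_norm1 (x k) ^+ 2)%E.
  by apply: nneseries_ge0 => k _ _; exact: sq0.
have [n] := exp_8_7_unbounded (fine (\sum_(0 <= k <oo) seq_norm1 (x k) ^+ 2)%E).
rewrite ltNge => /negP; apply; apply: (factor_ge x1 xA) => N.
rewrite -lee_fin fineK ?ge0_fin_numE// -sumEFin.
rewrite (eq_bigr (fun k => seq_norm1 (x k) ^+ 2)%E); last first.
  by move=> k _; rewrite EFin_expe fineK// ge0_fin_numE ?seq_norm1_ge0.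
exact: nneseries_lim_ge.
Qed.

End Construction.

(** * Real and complex scalars *)

Lemma normr_summable_cvg (R : realType) (u : nat -> R) (M : R) :
  (forall N, \sum_(0 <= k < N) `|u k| <= M) -> cvgn (series u).
Proof.
move=> uM; apply: normed_cvg; apply: nondecreasing_is_cvgn.
  by apply: nondecreasing_series => k _ _; exact: normr_ge0.
by exists M => _ [N _ <-]; exact: uM.
Qed.

Lemma sqrt_addsqr_le (R : realType) (a b : R) :
  Num.sqrt (a ^+ 2 + b ^+ 2) <= `|a| + `|b|.
Proof.
rewrite -[leRHS]ger0_norm ?addr_ge0// -sqrtr_sqr ler_wsqrtr//.
by rewrite sqrrD !real_normK ?num_real// addrAC lerDl mulrn_wge0// mulr_ge0.
Qed.

(** Real and imaginary parts are dominated by the modulus, so both series converge; their limits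
    assemble into the complex one, with error at most the sum of the two real errors. *)
Lemma complex_summable_cvg (R : realType) (u : nat -> complex_scalars R) :
  (exists M : R, forall N, \sum_(0 <= k < N) sabs (u k) <= M) -> cvgn (series u).
Proof.
move=> [M uM].
pose re k : R := complex.Re (u k : R[i]); pose im k : R := complex.Im (u k : R[i]).
have uE k : sabs (u k) = Num.sqrt (re k ^+ 2 + im k ^+ 2).
  by rewrite /re /im /=; case: (u k).
have reM : cvgn (series re).
  apply: (@normr_summable_cvg _ _ M) => N; apply: le_trans (uM N).
  by apply: ler_sum => k _; rewrite uE -sqrtr_sqr ler_wsqrtr// lerDl sqr_ge0.
have imM : cvgn (series im).
  apply: (@normr_summable_cvg _ _ M) => N; apply: le_trans (uM N).
  by apply: ler_sum => k _; rewrite uE -sqrtr_sqr ler_wsqrtr// lerDr sqr_ge0.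
pose l : complex_scalars R := (limn (series re) +i* limn (series im))%C.
apply/cvg_ex; exists l; apply: sabs_cvg.
have bnd N : sabs (series u N - l) <=
    `|series re N - limn (series re)| + `|series im N - limn (series im)|.
  have hR : complex.Re (series u N - l : R[i]) = series re N - limn (series re).
    by rewrite raddfB; congr (_ - _); exact: raddf_sum.
  have hI : complex.Im (series u N - l : R[i]) = series im N - limn (series im).
    by rewrite raddfB; congr (_ - _); exact: raddf_sum.
  rewrite -hR -hI; case: (series u N - l : R[i]) => a b /=.
  exact: sqrt_addsqr_le.
apply: (@squeeze_cvgr _ _ _ _ (cst 0) (fun N => `|series re N - limn (series re)|
   + `|series im N - limn (series im)|)).
- by near=> N; rewrite sabs_ge0 bnd.
- exact: cvg_cst.
have tail (f : nat -> R) : cvgn (series f) ->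
    `|series f N - limn (series f)| @[N --> \oo] --> (0 : R).
  move=> fc; rewrite -[X in _ --> X](normr0 R) -(subrr (limn (series f))).
  by apply: cvg_norm; apply: cvgB; [exact: fc|exact: cvg_cst].
by rewrite -[X in _ --> X]addr0; apply: cvgD; exact: tail.
Unshelve. all: by end_near. Qed.

Theorem theorem5p5 (R : realType) :
  (exists A : {linear ell2 (real_scalars R) -> ell2 (real_scalars R)},
     Gamma A /\ ~ Gamma_plus A) /\
  (exists A : {linear ell2 (complex_scalars R) -> ell2 (complex_scalars R)},
     Gamma A /\ ~ Gamma_plus A).
Proof.
split.
- exists (@block_op R (real_scalars R)).
  have mul_cj (a : real_scalars R) :
    a * (idfun : {rmorphism real_scalars R -> real_scalars R}) a = `|a| ^+ 2.
    by rewrite /= -expr2 (real_normK (num_real (a : R))).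
  have cvgK (u : nat -> real_scalars R) :
     (exists M : R, forall N, \sum_(0 <= k < N) sabs (u k) <= M) ->
     cvgn (series u).
    by move=> [M uM]; exact: (@normr_summable_cvg R u M uM).
  split; first exact: block_op_Gamma mul_cj cvgK.
  exact: block_op_not_Gamma_plus mul_cj.
- exists (@block_op R (complex_scalars R)).
  have mul_cj (a : complex_scalars R) :
    a * (conjc : {rmorphism complex_scalars R -> complex_scalars R}) a = `|a| ^+ 2.
    by rewrite [RHS]sqr_normc.
  split; first exact: block_op_Gamma mul_cj (@complex_summable_cvg R).
  exact: block_op_not_Gamma_plus mul_cj.
Qed.
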